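(* Let $P,Q$ be integers and $p$ an odd prime such that $p\nmid P$ and $P^2-4Q$ is a quadratic nonresidue modulo $p$. Suppose that the multiplicative order of $Q$ modulo $p$ equals $\frac{p-1}{k}$ for some $k\in\{1,2\}$. Let $F=[P,Q]$, let $\pi=\pi(p)$ be its Pisano period modulo $p$, and let $\rho=\rho(p)$ be its rank of apparition modulo $p$. Then $F$ is complete modulo $p$. More precisely: (a) If $p\equiv 1\pmod 4$, or if $p\equiv 3 \pmod 4$ and $\rho$ is even, then $0$ appears in the full period $(F_1 \bmod p,\ldots,F_{\pi}\bmod p)$ exactly $p-1$ times, while each nonzero element of $\mathbb{Z}/p\mathbb{Z}$ appears exactly $\rho-1$ times. (b) If $p\equiv 3\pmod 4$ and $\rho$ is odd, then either (i) $0$ appears in the full period exactly $p-1$ times while each nonzero element of $\mathbb{Z}/p\mathbb{Z}$ appears exactly $\rho-1$ times, or (ii) $0$ appears in the full period exactly $(p-1)/2$ times while each nonzero element of $\mathbb{Z}/p\mathbb{Z}$ appears exactly $(\rho-1)/2$ times.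
   Context: $[P,Q]$ denotes the sequence $F_0=0$, $F_1=1$, $F_{n+1}=PF_n-QF_{n-1}$ ($n\ge1$). It is complete modulo $p$ if every residue class mod $p$ equals $F_n \bmod p$ for some $n\ge0$. The Pisano period $\pi(p)$ is the least positive $n$ with $F_{n+k}\equiv F_k\pmod p$ for all $k\ge 0$; the full period is the finite sequence of residues $F_1,\dots,F_{\pi(p)}$ modulo $p$ (counted with multiplicity). The rank of apparition $\rho(p)$ is the least positive integer $n$ with $F_n\equiv 0\pmod p$. *)

(* Defs.v *)
From mathcomp Require Import all_boot all_order all_algebra.

Set Implicit Arguments.
Unset Strict Implicit.
Unset Printing Implicit Defensive.

Import Order.TTheory GRing.Theory Num.Theory.
Local Open Scope ring_scope.

Fixpoint lucas (P Q : int) (n : nat) : int :=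
  match n with
  | 0 => 0
  | m.+1 => if m is l.+1 then P * lucas P Q m - Q * lucas P Q l else 1
  end.

Definition least_positive (A : nat -> Prop) (n : nat) : Prop :=
  [/\ (0 < n)%N, A n & forall m : nat, (0 < m)%N -> A m -> (n <= m)%N].

Definition quadratic_nonresidue (p : nat) (a : int) : Prop :=
  ~~ (p %| a)%Z /\ ~ exists x : int, (x ^+ 2 = a %[mod p])%Z.

(* No [n] satisfies this when [a] is not invertible modulo [p]. *)
Definition is_mult_order (p : nat) (a : int) (n : nat) : Prop :=
  least_positive (fun m => (a ^+ m = 1 %[mod p])%Z) n.

Definition is_pisano_period (P Q : int) (p n : nat) : Prop :=
  least_positive
    (fun m => forall k : nat,
       (lucas P Q (m + k) = lucas P Q k %[mod p])%Z) n.

Definition is_rank_of_apparition (P Q : int) (p n : nat) : Prop :=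
  least_positive (fun m => (lucas P Q m = 0 %[mod p])%Z) n.

(* The next definitions are meant for prime [p], where ['F_p] is Z/pZ. *)
Definition complete_mod (P Q : int) (p : nat) : Prop :=
  forall x : 'F_p, exists n : nat, (lucas P Q n)%:~R = x.

Definition residues (P Q : int) (p n : nat) : seq 'F_p :=
  [seq (lucas P Q i)%:~R | i <- iota 1 n].

Definition has_frequencies (p : nat) (s : seq 'F_p) (a b : nat) : Prop :=
  count_mem 0 s = a /\ forall x : 'F_p, x != 0 -> count_mem x s = b.

(* Main.v *)
Require Import Defs.
From mathcomp Require Import all_boot all_order all_algebra all_field.
From mathcomp Require Import ring zify.

(** Let z be a root of X^2 - PX + Q in a quadratic extension of F_p. The
    nonresidue condition makes z^p the other root, so F_n is a multiple of
    z^n - z^(pn). With m the order of z this gives period m, rank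
    rho = m / d where d = gcd(p - 1, m), and d zeros per period; moreover
    F_(n+rho) = c F_n with c = z^rho of order d in F_p, and F_(pn) = - F_n.
    Since Q = z^(p+1) has order m / gcd(p + 1, m) = (p - 1)/k, either
    d = p - 1, or d = (p - 1)/2 with d and rho odd; in both cases c and -1
    generate F_p^*. So multiplication by any nonzero scalar preserves the
    frequencies, hence all nonzero residues are equally frequent. *)

Set Implicit Arguments.
Unset Strict Implicit.
Unset Printing Implicit Defensive.

Import GRing.Theory.
Local Open Scope ring_scope.

(** * Residues in ['F_p] and the conjugate roots of the characteristic polynomial *)

Lemma eqz_mod_Fp (p : nat) (a b : int) :
  prime p -> (a = b %[mod p])%Z <-> a%:~R = b%:~R :> 'F_p.
Proof.
move=> p_pr; split=> [/eqP|] eq_ab.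
  by apply/eqP; rewrite -subr_eq0 -rmorphB -(dvdz_pcharf (pchar_Fp p_pr)) -eqz_mod_dvd.
by apply/eqP; rewrite eqz_mod_dvd (dvdz_pcharf (pchar_Fp p_pr)) rmorphB /= eq_ab subrr.
Qed.

Lemma expFp (p : nat) (x : 'F_p) : prime p -> x ^+ p = x.
Proof. by move=> p_pr; rewrite -[X in _ ^+ X](card_Fp p_pr) expf_card. Qed.

Lemma quadratic_root_extension (F : finFieldType) (a b : F) :
  exists (L : fieldType) (phi : {rmorphism F -> L}) (z : L),
    z ^+ 2 - phi a * z + phi b = 0.
Proof.
pose q : {poly F} := 'X^2 - a *: 'X + b%:P.
have sz_q : size q = 3.
  rewrite /q -addrA size_polyDl ?size_polyXn //.
  rewrite (leq_ltn_trans (size_polyD _ _)) // gtn_max size_polyN.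
  rewrite (leq_ltn_trans (size_scale_leq _ _)) ?size_polyX //.
  by rewrite (leq_ltn_trans (size_polyC_leq1 _)).
have q_neq0 : q != 0 by rewrite -size_poly_gt0 sz_q.
have [L [rs q_rs _]] := FinSplittingFieldFor q_neq0.
exists L, (GRing.in_alg L).
(* The list of roots is nonempty because [q] is not constant; its head is the required root. *)
case: rs q_rs => [|z rs] q_rs.
  by have := eqp_size q_rs; rewrite size_map_poly sz_q big_nil size_poly1.
exists z; have : root (map_poly (GRing.in_alg L) q) z.
  by rewrite (eqp_root q_rs) root_prod_XsubC mem_head.
rewrite rootE => /eqP <-.
by rewrite /q rmorphD rmorphB /= map_polyC map_polyXn linearZ /= map_polyX !hornerE.
Qed.

(** If z^p = z, then z is a root of X^p - X, the product of all X - x, so z comes from ['F_p] and 2z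
    - a is a square root of the discriminant. Otherwise Frobenius makes z^p a second root, and
    Vieta's formulas follow. *)
Lemma quadratic_root_conj (p : nat) (L : fieldType)
    (phi : {rmorphism 'F_p -> L}) (z : L) (a b : 'F_p) :
  prime p -> (forall x : 'F_p, x ^+ 2 != a ^+ 2 - 4 * b) ->
  z ^+ 2 - phi a * z + phi b = 0 ->
  [/\ z ^+ p != z, z + z ^+ p = phi a & z * z ^+ p = phi b].
Proof.
move=> p_pr nonsq z_root.
have pcharL : p \in [pchar L] by exact: (rmorph_pchar phi (pchar_Fp p_pr)).
have zp_neq : z ^+ p != z.
  apply/negP => /eqP zp_eq.
  have : (map_poly phi ('X^#|'F_p| - 'X)).[z] = 0.
    by rewrite rmorphB /= map_polyXn map_polyX !hornerE card_Fp // zp_eq subrr.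
  rewrite finField_genPoly rmorph_prod horner_prod => /eqP/prodf_eq0[x _].
  rewrite /= map_polyXsubC hornerXsubC subr_eq0 => /eqP z_eq.
  move: z_root; rewrite z_eq -rmorphXn -rmorphM -rmorphB -rmorphD -(rmorph0 phi).
  move/fmorph_inj => x_root.
  have /eqP[] := nonsq (2 * x - a).
  have -> : (2 * x - a) ^+ 2 = a ^+ 2 - 4 * b + 4 * (x ^+ 2 - a * x + b) by ring.
  by rewrite x_root mulr0 addr0.
have zp_root : (z ^+ p) ^+ 2 - phi a * z ^+ p + phi b = 0.
  have := congr1 (pFrobenius_aut pcharL) z_root.
  by rewrite rmorph0 rmorphD rmorphB rmorphXn rmorphM /= !pFrobenius_autE -!rmorphXn !expFp.
have sum_z : z + z ^+ p = phi a.
  (* The two root equations differ by (z^p - z)(z + z^p - a), whose first factor can be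
     cancelled. *)
  have zp_z_neq0 : z ^+ p - z != 0 by rewrite subr_eq0.
  apply/(mulfI zp_z_neq0)/eqP; rewrite -subr_eq0; apply/eqP.
  rewrite -[RHS](subrr 0) -{1}zp_root -z_root; ring.
split=> //; apply/eqP; rewrite -subr_eq0 -sum_z in z_root *.
have -> : z * z ^+ p - phi b = - (z ^+ 2 - (z + z ^+ p) * z + phi b) by ring.
by rewrite z_root oppr0.
Qed.

(** * Binet's formula, reindexing of periodic sums, and arithmetic of orders *)

Lemma lucas_binet (R : comPzRingType) (P Q : int) (u v : R) (n : nat) :
  u + v = P%:~R -> u * v = Q%:~R ->
  (lucas P Q n)%:~R * (u - v) = u ^+ n - v ^+ n.
Proof.
move=> sum_uv prod_uv.
suff [] : (lucas P Q n)%:~R * (u - v) = u ^+ n - v ^+ n /\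
  (lucas P Q n.+1)%:~R * (u - v) = u ^+ n.+1 - v ^+ n.+1 by [].
elim: n => [|n [IHn IHn1]]; first by rewrite mul0r mul1r !expr0 subrr.
split=> //; rewrite [lucas _ _ _]/= -/(lucas P Q n.+1).
rewrite rmorphB !rmorphM /= mulrBl -!mulrA IHn IHn1 -sum_uv -prod_uv !exprS.
by ring.
Qed.

(** The map sending i to a * i + b permutes the residues modulo [m]. It is applied below to the
    shifts by 1 and by [rho], and to multiplication by [p]. *)
Lemma sum_periodic_affine (T : eqType) (f : nat -> T) (m a b : nat) (x : T) :
  (forall i, f (i %% m)%N = f i) -> coprime a m ->
  (\sum_(i < m) (f (a * i + b) == x) = \sum_(i < m) (f i == x))%N.
Proof.
case: m => [|m] f_mod co_am; first by rewrite !big_ord0.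
pose h (i : 'I_m.+1) : 'I_m.+1 := Ordinal (ltn_pmod (a * i + b) (ltn0Sn m)).
have h_inj : injective h.
  move=> i j /(congr1 val)/eqP /=; rewrite eqn_modDr => /eqP eq_ij.
  apply/val_inj; rewrite /= -(modn_small (ltn_ord i)) -(modn_small (ltn_ord j)).
  wlog le_ij : i j eq_ij / (i <= j)%N.
    by case/orP: (leq_total i j) => [le_ij|le_ji] Hw; [exact: Hw | symmetry; exact: Hw].
  apply/esym/eqP; rewrite eqn_mod_dvd // -(@Gauss_dvdr _ a) 1?coprime_sym //.
  by rewrite mulnBr -eqn_mod_dvd ?leq_mul2l ?le_ij ?orbT // eq_ij.
rewrite [RHS](reindex_inj h_inj); apply: eq_bigr => i _.
by rewrite /= f_mod.
Qed.

(* Here [m] is the order of [z], so [m %/ gcdn p.+1 m] is that of [Q = z ^+ p.+1]. *)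
Lemma gcdn_pred_order_cases (p k m : nat) :
  odd p -> k = 1%N \/ k = 2%N -> (0 < m)%N ->
  (m %/ gcdn p.+1 m = (p - 1) %/ k)%N ->
  gcdn p.-1 m = p.-1 \/
  [/\ gcdn p.-1 m = p.-1./2, odd (gcdn p.-1 m) & odd (m %/ gcdn p.-1 m)].
Proof.
move=> odd_p k12 m_gt0 ord_Q.
have /= := divnK (dvdn_gcdr p.+1 m); rewrite ord_Q.
set g := gcdn p.+1 m => m_eq.
have even_p1 : ~~ odd p.-1 by lia.
case: k12 => k_eq; rewrite k_eq ?divn1 in m_eq.
  by left; apply/gcdn_idPl; rewrite -m_eq -subn1 dvdn_mulr.
set h := p.-1./2; have p1_eq : p.-1 = (h * 2)%N by rewrite /h; lia.
have {}m_eq : m = (h * g)%N by rewrite -m_eq; congr (_ * _)%N; rewrite /h; lia.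
have [g_even|odd_g] := boolP (2 %| g)%N.
  by left; apply/gcdn_idPl; rewrite p1_eq m_eq dvdn_mul.
have {}odd_g : odd g by rewrite -[odd g]negbK -dvdn2.
(* If [h] were even, 2 would divide both p + 1 and m = h * g, hence their gcd [g]. *)
have odd_h : odd h.
  apply: contraT => even_h; move: odd_g; rewrite -[odd g]negbK -dvdn2 dvdn_gcd.
  by rewrite m_eq !dvdn2 oddM (negPf even_h) /= odd_p.
have d_eq : gcdn p.-1 m = h.
  by rewrite p1_eq m_eq -muln_gcdr; move: odd_g; rewrite -coprime2n => /eqP->; rewrite muln1.
by right; rewrite d_eq m_eq mulKn // odd_gt0.
Qed.

(** * Zeros, period and symmetries of the sequence, read off from the order of [z] *)

Section Frequencies.

Variables (P Q : int) (p : nat) (L : fieldType).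
Variables (phi : {rmorphism 'F_p -> L}) (z : L) (m : nat).
Hypotheses (p_pr : prime p) (zp_neq : z ^+ p != z).
Hypotheses (sum_z : z + z ^+ p = P%:~R) (prod_z : z * z ^+ p = Q%:~R).
Hypothesis z_ord : m.-primitive_root z.

Let f (n : nat) : 'F_p := (lucas P Q n)%:~R.
Let d := gcdn p.-1 m.
Let rho := (m %/ d)%N.

Let m_gt0 : (0 < m)%N := prim_order_gt0 z_ord.

Let z_neq0 : z != 0.
Proof. by apply: contraNneq zp_neq => ->; rewrite expr0n gtn_eqF ?prime_gt0. Qed.

Let diff_neq0 : z - z ^+ p != 0.
Proof. by rewrite subr_eq0 eq_sym. Qed.

Let binet n : phi (f n) * (z - z ^+ p) = z ^+ n - z ^+ (p * n).
Proof. by rewrite rmorph_int exprM (lucas_binet _ sum_z prod_z). Qed.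

Let f_inj i j : z ^+ i - z ^+ (p * i) = z ^+ j - z ^+ (p * j) -> f i = f j.
Proof. by rewrite -!binet => /(mulIf diff_neq0)/fmorph_inj. Qed.

(** By Binet, the zeros are the n with z^n = z^(pn), that is (z^(p-1))^n = 1, and z^(p-1) has order
    m / gcd(p - 1, m). *)
Lemma lucas_eq0 n : (f n == 0) = (rho %| n)%N.
Proof.
rewrite (prim_order_dvd (exp_prim_root z_ord p.-1)) -exprM.
rewrite -(fmorph_eq0 phi) -(inj_eq (mulIf diff_neq0)) mul0r binet subr_eq0.
rewrite -(prednK (prime_gt0 p_pr)) mulSn exprD -{1}[z ^+ n]mulr1.
by rewrite (inj_eq (mulfI _)) ?expf_neq0 // eq_sym.
Qed.

Let rho_dvd : (rho %| m)%N.
Proof. by apply/dvdnP; exists d; rewrite mulnC divnK ?dvdn_gcdr. Qed.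

Let rho_gt0 : (0 < rho)%N.
Proof. exact: dvdn_gt0 rho_dvd. Qed.

Let f_mod i : f (i %% m)%N = f i.
Proof.
by apply: f_inj; rewrite !(mulnC p) !exprM !(prim_expr_mod z_ord).
Qed.

Lemma pisano_order : is_pisano_period P Q p m.
Proof.
split=> // [n|n n_gt0 period_n].
  by apply/eqz_mod_Fp => //; rewrite -/(f _) -/(f n) -f_mod modnDl f_mod.
have f_n0 : f n = 0 by have /eqz_mod_Fp := period_n 0%N; rewrite addn0; exact.
have f_n1 : f n.+1 = 1 by have /eqz_mod_Fp := period_n 1%N; rewrite addn1; exact.
apply: dvdn_leq => //; rewrite (prim_order_dvd z_ord); apply/eqP.
(* F_n = 0 gives z^n = z^(pn); then F_(n+1) = 1 reads z^n (z - z^p) = z - z^p, so z^n = 1. *)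
have := binet n; rewrite f_n0 rmorph0 mul0r => /esym/subr0_eq zn_eq.
have := binet n.+1; rewrite f_n1 rmorph1 mul1r mulnS exprS exprD -zn_eq.
by rewrite -mulrBl -{1}[z - _]mulr1 => /(mulfI diff_neq0).
Qed.

Lemma rank_of_apparition_order : is_rank_of_apparition P Q p rho.
Proof.
split=> // [|n n_gt0].
  by apply/eqz_mod_Fp => //; apply/eqP; rewrite [_ == _]lucas_eq0.
by move/eqz_mod_Fp => /(_ p_pr)/eqP; rewrite [_ == _]lucas_eq0; exact: dvdn_leq.
Qed.

Let z_rho : z ^+ (p * rho) = z ^+ rho.
Proof.
have := binet rho; have /eqP-> : f rho == 0 by rewrite lucas_eq0.
by rewrite rmorph0 mul0r => /esym/subr0_eq.
Qed.

(** The multiplier z^rho is fixed by Frobenius, so it lies in the prime field; F_(rho+1) names it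
    there. *)
Let phi_multiplier : phi (f rho.+1) = z ^+ rho.
Proof.
apply: (mulIf diff_neq0); rewrite binet mulnS exprS exprD z_rho; ring.
Qed.

Lemma lucas_add_rank n : f (n + rho) = f rho.+1 * f n.
Proof.
apply/(fmorph_inj phi)/(mulIf diff_neq0).
rewrite rmorphM /= phi_multiplier -mulrA !binet mulnDr !exprD z_rho; ring.
Qed.

(** Since Q lies in the prime field, z^(p^2) z^p = (z z^p)^p = Q^p = Q = z z^p; cancel z^p. *)
Let z_pp : z ^+ (p * p) = z.
Proof.
apply: (mulIf (expf_neq0 p z_neq0)); rewrite exprM -exprMn [_ * z]mulrC prod_z.
by rewrite -(rmorph_int phi) -rmorphXn expFp.
Qed.

(** Raising to the power p exchanges the two roots, which flips the sign of z^n - z^(pn). *)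
Lemma lucas_mul_p n : f (p * n) = - f n.
Proof.
apply/(fmorph_inj phi)/(mulIf diff_neq0).
by rewrite rmorphN mulNr /= !binet mulnA [z ^+ (p * p * n)]exprM z_pp opprB.
Qed.

Let coprime_p_order : coprime p m.
Proof.
have pp_gt0 : (0 < p * p)%N by rewrite muln_gt0 prime_gt0.
apply: coprime_dvdl (dvdn_mulr p (dvdnn p)) _.
apply: (coprime_dvdr (n := (p * p).-1)); last by rewrite coprimenP.
rewrite (prim_order_dvd z_ord); apply/eqP/(mulIf z_neq0).
by rewrite mul1r -exprSr prednK.
Qed.

Let N (x : 'F_p) := count_mem x (residues P Q p m).

(** The full period is listed from index 1 to m, the sum runs from 0 to m - 1; periodicity absorbs
    the shift. *)
Let N_sum x : N x = (\sum_(i < m) (f i == x))%N.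
Proof.
rewrite -(sum_periodic_affine 1 x f_mod (coprime1n m)).
rewrite /N -sum1_count big_map big_mkcond /=.
have -> : iota 1 m = index_iota 1 m.+1 by rewrite /index_iota subn1.
rewrite big_add1 big_mkord.
by apply: eq_bigr => i _; rewrite mul1n addn1; case: ifP.
Qed.

(** The zeros sit at the multiples of [rho] in 1..m, and there are m / rho of them. *)
Lemma count_residues0 : N 0 = d.
Proof.
have d_eq : d = (m %/ rho)%N.
  by rewrite -[X in (X %/ _)%N](divnK (dvdn_gcdr p.-1 m)) -/d -/rho mulKn.
rewrite d_eq divn_count_dvd /N -sum1_count big_map big_mkcond /=.
have -> : iota 1 m = index_iota 1 m.+1 by rewrite /index_iota subn1.
by apply: eq_bigr => i _; rewrite -lucas_eq0 [f i == 0]/=; case: ifP.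
Qed.

Lemma count_residues_multiplier x : N (f rho.+1 * x) = N x.
Proof.
rewrite !N_sum -(sum_periodic_affine rho _ f_mod (coprime1n m)).
apply: eq_bigr => i _; rewrite mul1n lucas_add_rank (inj_eq (mulfI _)) //.
by rewrite -(fmorph_eq0 phi) phi_multiplier expf_neq0.
Qed.

Lemma count_residues_opp x : N (- x) = N x.
Proof.
rewrite !N_sum -(sum_periodic_affine 0 _ f_mod coprime_p_order).
by apply: eq_bigr => i _; rewrite addn0 lucas_mul_p eqr_opp.
Qed.

(** The powers of the multiplier are exactly the solutions of y^d = 1, which is all of the unit
    group if d = p - 1. If d = (p - 1)/2 is odd, then x^d is 1 or -1, and in the second case (-x)^d
    = 1. *)
Lemma count_residues_const x :
  d = p.-1 \/ d = p.-1./2 /\ odd d -> odd p -> x != 0 -> N x = N 1.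
Proof.
move=> d_cases odd_p x_neq0.
have c_ord : d.-primitive_root (f rho.+1).
  rewrite -(fmorph_primitive_root phi) phi_multiplier.
  have := exp_prim_root z_ord rho; move/gcdn_idPl: rho_dvd => ->.
  by rewrite -{1}(divnK (dvdn_gcdr p.-1 m)) mulnC mulnK.
have powers y : y ^+ d = 1 -> N y = N 1.
  case/(prim_rootP c_ord) => [[i /= _] ->]; elim: i => // i IHi.
  by rewrite exprS count_residues_multiplier.
have xp1 : x ^+ p.-1 = 1.
  by apply: (mulfI x_neq0); rewrite -exprS prednK ?prime_gt0 // mulr1 expFp.
case: d_cases => [d_eq|[d_eq odd_d]]; first by apply: powers; rewrite d_eq.
have : x ^+ d ^+ 2 == 1.
  by rewrite -exprM d_eq muln2 halfK -subn1 oddB ?prime_gt0 // odd_p subn0 subn1 xp1.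
rewrite sqrf_eq1 => /orP[/eqP|/eqP xd]; first exact: powers.
rewrite -count_residues_opp; apply: powers.
by rewrite exprNn xd -signr_odd odd_d mulrNN mul1r.
Qed.

Lemma sum_count_residues : (\sum_x N x = m)%N.
Proof.
under eq_bigr do rewrite N_sum.
rewrite exchange_big /= -[RHS]card_ord -sum1_card; apply: eq_bigr => i _.
by rewrite (bigD1 (f i)) //= eqxx big1 // => x /negPf; rewrite eq_sym => ->.
Qed.

(** Counting the m = rho d terms gives rho d = d + (p - 1) N(1). The quotient serves both cases: it
    becomes rho - 1 for d = p - 1, and (rho - 1)/2 for d = (p - 1)/2. *)
Lemma residues_frequencies :
  d = p.-1 \/ d = p.-1./2 /\ odd d -> odd p ->
  has_frequencies (residues P Q p m) d ((rho - 1) * d %/ p.-1).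
Proof.
move=> d_cases odd_p; split=> [|x x_neq0]; first exact: count_residues0.
have p1_gt0 : (0 < p.-1)%N by rewrite -subn1 subn_gt0 prime_gt1.
rewrite [LHS](count_residues_const d_cases) //.
have := sum_count_residues; rewrite (bigD1 0) //= count_residues0.
rewrite (eq_bigr (fun=> N 1)); last by move=> y; exact: count_residues_const.
rewrite sum_nat_const (cardC1 (0 : 'F_p)) card_Fp // => m_eq.
have -> : ((rho - 1) * d = p.-1 * N 1%R)%N.
  by rewrite mulnBl mul1n divnK ?dvdn_gcdr // -[X in (X - _)%N]m_eq addKn.
by rewrite mulKn.
Qed.

(** F_1 = 1 and F_2 = P are nonzero modulo p. The bound makes rho - 1 and (rho - 1)/2 positive, as
    completeness requires. *)
Lemma rank_gt2 : ~~ (p %| P)%Z -> (2 < rho)%N.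
Proof.
move=> pP; have f2 : f 2 != 0.
  by rewrite /f /= mulr1 mulr0 subr0 -(dvdz_pcharf (pchar_Fp p_pr)).
have f1 : f 1 != 0 by rewrite oner_neq0.
by move: rho_gt0 f1 f2; rewrite !lucas_eq0; case: rho => [|[|[|]]].
Qed.

End Frequencies.

(** * Comparison of orders, and assembly of the theorem *)

Lemma order_exp (R : nzRingType) (z : R) (m n k : nat) :
  m.-primitive_root z -> n.-primitive_root (z ^+ k) -> (m %/ gcdn k m)%N = n.
Proof.
move=> z_ord zk_ord; have zk_ord' := exp_prim_root z_ord k; apply/eqP.
by rewrite eqn_dvd (prim_order_dvd zk_ord') (prim_order_dvd zk_ord)
  (prim_expr_order zk_ord) (prim_expr_order zk_ord') eqxx.
Qed.

Lemma mult_order_primitive (p : nat) (a : int) (n : nat) :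
  prime p -> is_mult_order p a n -> n.-primitive_root (a%:~R : 'F_p).
Proof.
move=> p_pr [n_gt0 /eqz_mod_Fp-/(_ p_pr) an min_n].
rewrite rmorphXn rmorph1 /= in an.
have [j a_ord j_dvd] := prim_order_exists n_gt0 an.
suff -> : n = j by [].
apply/eqP; rewrite eqn_leq (dvdn_leq n_gt0 j_dvd) min_n ?(prim_order_gt0 a_ord) //.
by apply/eqz_mod_Fp; rewrite // rmorphXn rmorph1 /= prim_expr_order.
Qed.

Lemma has_frequencies_complete (P Q : int) (p n a b : nat) :
  has_frequencies (residues P Q p n) a b -> (0 < a)%N -> (0 < b)%N ->
  complete_mod P Q p.
Proof.
move=> [count0 count_neq0] a_gt0 b_gt0 x.
have : (0 < count_mem x (residues P Q p n))%N.
  by have [->|/count_neq0->] := eqVneq x 0; first rewrite count0.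
by rewrite -has_count has_pred1 => /mapP[i _ ->]; exists i.
Qed.

Local Close Scope ring_scope.

Theorem theorem3 (P Q : int) (p k : nat) :
  prime p -> odd p ->
  ~~ (p %| P)%Z ->
  quadratic_nonresidue p (P ^+ 2 - 4 * Q)%R ->
  k = 1 \/ k = 2 ->
  is_mult_order p Q ((p - 1) %/ k) ->
  complete_mod P Q p /\
  exists pi rho : nat,
    [/\ is_pisano_period P Q p pi,
        is_rank_of_apparition P Q p rho,
        (p = 1 %[mod 4] \/ (p = 3 %[mod 4] /\ ~~ odd rho)) ->
          has_frequencies (residues P Q p pi) (p - 1) (rho - 1)
      & (p = 3 %[mod 4] /\ odd rho) ->
          has_frequencies (residues P Q p pi) (p - 1) (rho - 1) \/
          has_frequencies (residues P Q p pi) ((p - 1) %/ 2) ((rho - 1) %/ 2)].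
Proof.
move=> p_pr odd_p pP [_ nonres] k12 Q_ord.
have nonsq (x : 'F_p) : (x ^+ 2 != P%:~R ^+ 2 - 4 * Q%:~R)%R.
  apply/eqP => x_sq; apply: nonres; exists (Posz x).
  apply/eqz_mod_Fp => //.
  by rewrite rmorphB /= !rmorphXn rmorphM /= -pmulrn natr_Zp x_sq.
have [L [phi [z z_root]]] := quadratic_root_extension (P%:~R : 'F_p)%R Q%:~R%R.
have [zp_neq sum_z prod_z] := quadratic_root_conj p_pr nonsq z_root.
have q_ord := mult_order_primitive p_pr Q_ord.
rewrite -(fmorph_primitive_root phi) -prod_z -exprS in q_ord.
(* [z] has finite order because its power z^(p+1) = Q has. *)
have [m z_ord _] : {m | m.-primitive_root%R z & m %| p.+1 * ((p - 1) %/ k)}.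
  apply: prim_order_exists; last by rewrite exprM prim_expr_order.
  by rewrite muln_gt0 (prim_order_gt0 q_ord).
have m_gt0 := prim_order_gt0 z_ord.
have cases := gcdn_pred_order_cases odd_p k12 m_gt0 (order_exp z_ord q_ord).
rewrite !rmorph_int in sum_z prod_z.
set d := gcdn p.-1 m in cases; set rho := m %/ d in cases.
have rho_gt2 : 2 < rho := rank_gt2 phi p_pr zp_neq sum_z prod_z z_ord pP.
have p_gt2 : 2 < p by rewrite odd_prime_gt2.
have freq : has_frequencies (residues P Q p m) d ((rho - 1) * d %/ p.-1).
  apply: (residues_frequencies phi p_pr zp_neq sum_z prod_z z_ord) => //.
  by case: cases => [|[]]; [left | right].
have is_pi := pisano_order phi p_pr zp_neq sum_z prod_z z_ord.
have is_rho := rank_of_apparition_order phi p_pr zp_neq sum_z prod_z z_ord.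
(* For d = p - 1 the larger frequencies hold whatever p is modulo 4. For d = (p - 1)/2, oddness of
   [d] excludes p = 1 modulo 4 and [rho] is odd, so only the second alternative of (b) has to be
   met. *)
have [d_eq|[d_eq odd_d odd_rho]] := cases; rewrite d_eq in freq.
  have {}freq : has_frequencies (residues P Q p m) (p - 1) (rho - 1).
    by rewrite mulnK -?subn1 ?subn_gt0 ?prime_gt1 // in freq.
  split; last by exists m, rho; split=> // _; left.
  by apply: (has_frequencies_complete freq); lia.
have {}freq : has_frequencies (residues P Q p m) ((p - 1) %/ 2) ((rho - 1) %/ 2).
  have p1_eq : p.-1 = 2 * p.-1./2 by lia.
  rewrite [X in _ %/ X]p1_eq divnMr in freq; last by lia.
  by rewrite divn2 subn1.
split; first by apply: (has_frequencies_complete freq); lia.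
exists m, rho; split=> // [[p_mod|[_]]|_]; [|by rewrite odd_rho|by right].
by move: odd_d; rewrite d_eq; lia.
Qed.
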